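(* Let $G$ be a chain graph with $n$ viewpoints and let $m\le n$ be the number of robots. Let $\mathcal{V}=\{V_1,\dots,V_m\}$ be an optimal (minimum dimension) $m$-partition of $G$ computed by means of the bisection algorithm below with tolerance $\varepsilon$, and let $d_{\max}$ be the dimension of $\mathcal V$. Let $l_i=\min_{v\in V_i}v$, $r_i=\max_{v\in V_i}v$, $d_i=r_i-l_i$, and let robot $i$ follow the trajectory with $x_i(t)=l_i$ for $t=0,2d_i,4d_i,\dots$ and $x_i(t)=r_i$ for $t=d_i,3d_i,5d_i,\dots$, moving at unit speed in between. This team trajectory has image $\mathcal{V}$ and minimum refresh time $2d_{\max}$. Moreover, the time complexity of designing such a trajectory is $O(n\log(\varepsilon^{-1}))$.
   Context: A chain roadmap has viewpoints $1,\dots,n$ and edges $\{i,i+1\}$ of positive length; points are identified with their distance from vertex $1$, so viewpoints are reals $0=v_1<\dots<v_n$. A team trajectory is $X=(x_1,\dots,x_m)$, $x_i:[0,T_f]\to[0,v_n]$ continuous, piecewise differentiable, speed at most $1$, where $T_f$ is a fixed horizon much larger than the time a single robot needs to visit all viewpoints. $\mathrm{RT}(X)=\max_v\max_{(t_1,t_2)\in\Omega(v,X)}(t_2-t_1)$, $\Omega(v,X)=\{(t_1,t_2)\in[0,T_f]^2:t_1\le t_2,\ x_i(t)\ne v\ \forall i,\ \forall t\in(t_1,t_2)\}$. The image of $X$ is $\{V_1,\dots,V_m\}$ where $V_i$ is the set of viewpoints visited by robot $i$. An $m$-partition is a collection of $m$ pairwise disjoint (possibly empty) subsets of the viewpoints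 with union all viewpoints; dimension $=\max_i(\max V_i-\min V_i)$. Left-induced partition $\Pi^\rho$: $a_1=v_1$, $a_j=\min\{v:v>a_{j-1}+\rho\}$ while nonempty, clusters $\{v: a_j\le v\le a_j+\rho\}$. Bisection algorithm with tolerance $0<\varepsilon<v_n/m$: $a:=0$, $b:=2v_n/m$, $\rho:=(a+b)/2$; while $b-a>2\varepsilon$: if $|\Pi^\rho|>m$ then $a:=\rho$ else $\Pi^*:=\Pi^\rho$, $b:=\rho$; $\rho:=(a+b)/2$; return $\Pi^*$. *)

(* Defs.v *)
From HB Require Import structures.
From mathcomp Require Import all_boot all_order all_algebra.
From mathcomp Require Import all_classical all_reals all_analysis.
From mathcomp Require Import ring lra.
(* so that [set0], [setT], ... denote finite sets of viewpoints *)
From mathcomp Require Import finset.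

Set Implicit Arguments.
Unset Strict Implicit.
Unset Printing Implicit Defensive.

Import Order.TTheory GRing.Theory Num.Theory.
Import numFieldNormedType.Exports.
Local Open Scope ring_scope.

(** * Chain roadmaps and partitions *)

(* The viewpoints are the indices [k : 'I_n] and [v k] is the distance of
   viewpoint [k] from the first one. *)
Definition chain (R : realType) (n : nat) (v : 'I_n -> R) : Prop :=
  (forall k : 'I_n, nat_of_ord k = 0%N -> v k = 0) /\
  (forall j k : 'I_n, (j < k)%N -> v j < v k).

(* [v_n]: the position of the last viewpoint. *)
Definition chain_length (R : realType) (n : nat) (v : 'I_n -> R) : R :=
  \big[Num.max/0]_(k < n) v k.

Definition m_partition (n m : nat) (V : 'I_m -> {set 'I_n}) : Prop :=
  (forall i j : 'I_m, i != j -> [disjoint V i & V j]) /\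
  \bigcup_(i < m) V i = [set: 'I_n].

(* On a chain, positions lie in [0, v_n], so the neutral elements [v_n] and [0]
   do not affect the minimum and maximum over a nonempty cluster. *)
Definition left_end (R : realType) (n : nat) (v : 'I_n -> R)
    (A : {set 'I_n}) : R :=
  \big[Num.min/chain_length v]_(k in A) v k.

Definition right_end (R : realType) (n : nat) (v : 'I_n -> R)
    (A : {set 'I_n}) : R :=
  \big[Num.max/0]_(k in A) v k.

(* Empty clusters do not count: they would contribute [0 - v_n <= 0]. *)
Definition dimension (R : realType) (n m : nat) (v : 'I_n -> R)
    (V : 'I_m -> {set 'I_n}) : R :=
  \big[Num.max/0]_(i < m) (right_end v (V i) - left_end v (V i)).

Definition optimal_partition (R : realType) (n m : nat) (v : 'I_n -> R)
    (V : 'I_m -> {set 'I_n}) : Prop :=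
  m_partition V /\
  forall W : 'I_m -> {set 'I_n}, m_partition W ->
    dimension v V <= dimension v W.

(** * Team trajectories and refresh time *)

(* Only the values on [0, Tf] matter.  Piecewise differentiable: differentiable
   at every interior time outside some finite list of times. *)
Definition robot_trajectory (R : realType) (Tf len : R) (x : R -> R) : Prop :=
  [/\ {within `[0, Tf], continuous x}%classic,
      forall t : R, 0 <= t <= Tf -> 0 <= x t <= len
    & exists s : seq R, forall t : R, 0 < t < Tf -> t \notin s ->
        derivable x t 1 /\ `|x^`()%classic t| <= 1].

Definition team_trajectory (R : realType) (n m : nat) (v : 'I_n -> R) (Tf : R)
    (X : 'I_m -> R -> R) : Prop :=
  forall i : 'I_m, robot_trajectory Tf (chain_length v) (X i).

Definition Omega (R : realType) (m : nat) (Tf : R) (X : 'I_m -> R -> R)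
    (p : R) : set (R * R) :=
  [set t | [/\ 0 <= t.1 <= Tf, 0 <= t.2 <= Tf, t.1 <= t.2
             & forall (i : 'I_m) (s : R), t.1 < s < t.2 -> X i s != p]]%classic.

(* The inner maximum is written as a supremum: for continuous trajectories
   [Omega] is compact, so that it is attained. *)
Definition refresh_time (R : realType) (n m : nat) (v : 'I_n -> R) (Tf : R)
    (X : 'I_m -> R -> R) : R :=
  \big[Num.max/0]_(k < n) sup [set t.2 - t.1 | t in Omega Tf X (v k)]%classic.

Definition image_of (R : realType) (n m : nat) (v : 'I_n -> R) (Tf : R)
    (X : 'I_m -> R -> R) (i : 'I_m) : {set 'I_n} :=
  [set k : 'I_n | `[< exists t : R, 0 <= t <= Tf /\ X i t = v k >]]%SET.

(* Unit-speed motion from [l] to [r] and back, with period [2 * (r - l)]: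
   see [zigzag_up] and [zigzag_down]. *)
Definition zigzag (R : realType) (l r t : R) : R :=
  let d := r - l in
  if d == 0 then l else
  let s := t - (Num.floor (t / (2 * d)))%:~R * (2 * d) in
  l + Num.min s (2 * d - s).

(* A robot without viewpoints stays at its parking point [park i]. *)
Definition partition_trajectory (R : realType) (n m : nat) (v : 'I_n -> R)
    (V : 'I_m -> {set 'I_n}) (park : 'I_m -> R) (i : 'I_m) (t : R) : R :=
  if V i == set0 then park i
  else zigzag (left_end v (V i)) (right_end v (V i)) t.

Lemma zigzag_up (R : realType) (l r t : R) (k : nat) : l < r ->
  (2 * k)%:R * (r - l) <= t <= (2 * k).+1%:R * (r - l) ->
  zigzag l r t = l + (t - (2 * k)%:R * (r - l)).
Proof.
move=> lr; have d0 : 0 < r - l by rewrite subr_gt0.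
rewrite /zigzag gt_eqF // -natr1 natrM; set d := r - l in d0 *.
move=> /andP[t1 t2].
have -> : Num.floor (t / (2 * d)) = k%:Z.
  apply: Num.Theory.floor_def.
  rewrite ler_pdivlMr ?ltr_pdivrMr ?mulr_gt0 // ?intrD -?pmulrn.
  by apply/andP; split; lra.
rewrite -pmulrn min_l; last by lra.
lra.
Qed.

Lemma zigzag_down (R : realType) (l r t : R) (k : nat) : l < r ->
  (2 * k).+1%:R * (r - l) <= t <= (2 * k).+2%:R * (r - l) ->
  zigzag l r t = r - (t - (2 * k).+1%:R * (r - l)).
Proof.
move=> lr; have d0 : 0 < r - l by rewrite subr_gt0.
rewrite /zigzag gt_eqF // -(natr1 (2 * k).+1) -(natr1 (2 * k)) natrM.
have [d dE] : {d | r - l = d} by exists (r - l).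
rewrite dE in d0 *.
move=> /andP[t1]; rewrite le_eqVlt => /orP[/eqP t2|t2].
  have -> : Num.floor (t / (2 * d)) = k.+1%:Z.
    apply: Num.Theory.floor_def.
    rewrite ler_pdivlMr ?ltr_pdivrMr ?mulr_gt0 // ?intrD -?pmulrn -natr1.
    by apply/andP; split; lra.
  rewrite -pmulrn -natr1 min_l; last by lra.
  lra.
have -> : Num.floor (t / (2 * d)) = k%:Z.
  apply: Num.Theory.floor_def.
  rewrite ler_pdivlMr ?ltr_pdivrMr ?mulr_gt0 // ?intrD -?pmulrn.
  by apply/andP; split; lra.
rewrite -pmulrn min_r; last by lra.
lra.
Qed.

(** * Left-induced partitions *)

Definition next_anchor (R : realType) (n : nat) (v : 'I_n -> R) (x : R) :
    option 'I_n :=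
  [pick k : 'I_n | (x < v k) && [forall j : 'I_n, (x < v j) ==> (v k <= v j)]].

(* For [0 <= rho] each anchor is larger than the previous one, so that [n]
   units of fuel are never exhausted. *)
Fixpoint anchors_from (R : realType) (n : nat) (v : 'I_n -> R) (rho : R)
    (fuel : nat) (a : 'I_n) : seq 'I_n :=
  a :: (if fuel is fuel'.+1 then
          if next_anchor v (v a + rho) is Some b
          then anchors_from v rho fuel' b else [::]
        else [::]).

Definition anchors (R : realType) (n : nat) (v : 'I_n -> R) (rho : R) :
    seq 'I_n :=
  if [pick k : 'I_n | nat_of_ord k == 0%N] is Some a
  then anchors_from v rho n a else [::].

Definition left_induced (R : realType) (n : nat) (v : 'I_n -> R) (rho : R) :
    seq {set 'I_n} :=
  [seq [set k : 'I_n | v a <= v k <= v a + rho]%SET | a <- anchors v rho].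

(** * Programs with a running time *)

(* [(x, c)]: the value [x], computed in [c] elementary steps.  An elementary
   step is an arithmetic operation or a comparison on reals or counters, the
   access to the position of a viewpoint, or one list operation. *)
Definition timed (A : Type) : Type := (A * nat)%type.
Definition ret (A : Type) (x : A) : timed A := (x, 0%N).
Definition steps (A : Type) (c : nat) (x : A) : timed A := (x, c).
Definition op (A : Type) (x : A) : timed A := steps 1 x.
Definition bind (A B : Type) (e : timed A) (f : A -> timed B) : timed B :=
  ((f e.1).1, (e.2 + (f e.1).2)%N).

Notation "'do' x <- e1 ; e2" := (bind e1 (fun x => e2))
  (at level 200, x name, e1 at level 100, e2 at level 200).
Notation "'do' ' p <- e1 ; e2" := (bind e1 (fun p => e2))
  (at level 200, p pattern, e1 at level 100, e2 at level 200).

(* Big-step semantics: the loop started in state [s] ends in state [s'] after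
   [c] elementary steps. *)
Inductive while (S : Type) (guard : S -> timed bool) (body : S -> timed S) :
    S -> S -> nat -> Prop :=
| while_stop (s : S) :
    (guard s).1 = false -> while guard body s s (guard s).2
| while_iter (s s' : S) (c : nat) :
    (guard s).1 = true -> while guard body (body s).1 s' c ->
    while guard body s s' ((guard s).2 + (body s).2 + c).

(** * The bisection algorithm *)

(* The state consists of [a], [b], [rho] and of the partition found so far.
   The algorithm is parametrized by the type of clusters and by the subroutine
   [Pi] computing the left-induced partition for a given [rho]. *)
Definition bisection_state (R : realType) (A : Type) : Type :=
  (R * R * R * option (seq A))%type.

Definition bisection_init (R : realType) (A : Type) (len : R) (m : nat) :
    timed (bisection_state R A) :=
  do x <- op (2 * len);
  do b <- op (x / m%:R);
  do y <- op (0 + b);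
  do rho <- op (y / 2);
  ret (0, b, rho, None).

Definition bisection_guard (R : realType) (A : Type) (eps : R)
    (s : bisection_state R A) : timed bool :=
  let: (a, b, _, _) := s in
  do x <- op (b - a);
  do y <- op (2 * eps);
  op (y < x).

Definition bisection_body (R : realType) (A : Type) (Pi : R -> timed (seq A))
    (m : nat) (s : bisection_state R A) : timed (bisection_state R A) :=
  let: (a, b, rho, best) := s in
  do P <- Pi rho;
  do k <- steps (size P).+1 (size P);
  do big <- op (m < k)%N;
  do '(a', b', best') <-
    op (if big then (rho, b, best) else (a, rho, Some P));
  do x <- op (a' + b');
  do rho' <- op (x / 2);
  ret (a', b', rho', best').

(* The algorithm stops after [c] elementary steps and returns [P]. *)
Definition bisection (R : realType) (A : Type) (Pi : R -> timed (seq A))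
    (len : R) (m : nat) (eps : R) (P : seq A) (c : nat) : Prop :=
  exists (a b rho : R) (c' : nat),
    while (bisection_guard eps) (bisection_body Pi m)
      (bisection_init A len m).1 (a, b, rho, Some P) c' /\
    c = ((bisection_init A len m).2 + c')%N.

(* The [m]-partition given by a list of at most [m] clusters: the remaining
   clusters are empty. *)
Definition pad (n m : nat) (P : seq {set 'I_n}) (i : 'I_m) : {set 'I_n} :=
  nth set0 P i.

Definition bisection_partition (R : realType) (n m : nat) (v : 'I_n -> R)
    (eps : R) (V : 'I_m -> {set 'I_n}) : Prop :=
  exists (P : seq {set 'I_n}) (c : nat),
    bisection (fun rho => ret (left_induced v rho)) (chain_length v) m eps P c
    /\ V =1 pad P.

(** * An implementation, for the running time *)

(* A single scan of the viewpoints.  [scan_from v rho a s] returns the elements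
   of [s] belonging to the cluster anchored at position [a], together with the
   subsequent clusters. *)
Fixpoint scan_from (R : realType) (n : nat) (v : 'I_n -> R) (rho a : R)
    (s : seq 'I_n) : timed (seq 'I_n * seq (seq 'I_n)) :=
  if s is k :: s' then
    do x <- op (v k);
    do y <- op (a + rho);
    do near <- op (x <= y);
    if near then
      do '(c, cs) <- scan_from v rho a s';
      do c' <- op (k :: c);
      ret (c', cs)
    else
      do '(c, cs) <- scan_from v rho x s';
      do c' <- op (k :: c);
      do cs' <- op (c' :: cs);
      ret ([::], cs')
  else op ([::], [::]).

Definition scan (R : realType) (n : nat) (v : 'I_n -> R) (rho : R) :
    timed (seq (seq 'I_n)) :=
  if enum 'I_n is k :: s then
    do x <- op (v k);
    do '(c, cs) <- scan_from v rho x s;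
    do c' <- op (k :: c);
    op (c' :: cs)
  else op [::].

Fixpoint timed_last (T : Type) (x : T) (s : seq T) : timed T :=
  if s is y :: s' then do z <- op y; timed_last z s' else op x.

(* The end points of the trajectories of [m] robots, [None] for a robot without
   viewpoints. *)
Fixpoint robot_ends (R : realType) (n : nat) (v : 'I_n -> R) (m : nat)
    (P : seq (seq 'I_n)) : timed (seq (option (R * R))) :=
  match m, P with
  | m'.+1, (k :: c) :: P' =>
      do l <- op (v k);
      do j <- timed_last k c;
      do r <- op (v j);
      do ends <- robot_ends v m' P';
      op (Some (l, r) :: ends)
  | m'.+1, _ =>
      do ends <- robot_ends v m' (behead P);
      op (None :: ends)
  | 0, _ => op [::]
  end%N.

(* The design procedure stops after [c] elementary steps and returns [ends]. *)
Definition design (R : realType) (n : nat) (v : 'I_n -> R) (m : nat) (eps : R)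
    (ends : seq (option (R * R))) (c : nat) : Prop :=
  exists (P : seq (seq 'I_n)) (c' : nat),
    bisection (scan v) (chain_length v) m eps P c' /\
    ends = (robot_ends v m P).1 /\ c = (c' + (robot_ends v m P).2)%N.

Definition partition_ends (R : realType) (n m : nat) (v : 'I_n -> R)
    (V : 'I_m -> {set 'I_n}) : seq (option (R * R)) :=
  [seq if V i == set0 then None
       else Some (left_end v (V i), right_end v (V i)) | i <- enum 'I_m].

(* Main.v *)
Require Import Defs.
From HB Require Import structures.
From mathcomp Require Import all_boot all_order all_algebra.
From mathcomp Require Import all_classical all_reals all_analysis.
From mathcomp Require Import ring lra zify.
From mathcomp Require Import finset.

Set Implicit Arguments.
Unset Strict Implicit.
Unset Printing Implicit Defensive.

Import Order.TTheory GRing.Theory Num.Theory.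
Import numFieldNormedType.Exports.
Local Open Scope ring_scope.

(* Lower bound.  Suppose the refresh time is below [2 rho] with [rho] smaller
   than the minimum dimension.  The left-induced partition [Pi^rho] has
   dimension at most [rho], so it has more than [m] clusters, with anchors at
   mutual distance larger than [rho].  Every open time window of radius [rho] contains a visit
   of each anchor; since the speed is at most [1], induction on [j] shows that
   at all times in [j rho, Tf - j rho] at least [j] robots lie to the left of
   [a_j + rho] (the robots counted for [a_{j-1}] are strictly left of [a_j] when
   some robot visits [a_j], so that this visitor is a new one).  For [j = m + 1]
   this is absurd.  As the minimum dimension is at most [v_n / m], the window is
   nonempty as soon as [4 v_n <= Tf].

   Upper bound.  The zigzag position is [l] plus the distance of [t] to the
   multiples of [2 d]: it is 1-Lipschitz and passes through each point of
   [l, r] once per period at least.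

   Running time.  For [rho = v_n / m] there are at most [m] clusters, so the
   first iteration succeeds; [b - a] is halved in each iteration, and each
   iteration is a linear scan. *)

(** * Chains and clusters *)

Section Chain.
Variables (R : realType) (n : nat) (v : 'I_n -> R).
Hypothesis vP : chain v.
Implicit Types (a b j k : 'I_n) (A : {set 'I_n}) (rho eps : R).

Lemma ltr_chain j k : (v j < v k) = (j < k)%N.
Proof.
have [jk|kj|/val_inj ->] := ltngtP j k; last by rewrite ltxx.
  by rewrite vP.2.
by apply/negbTE; rewrite -leNgt ltW // vP.2.
Qed.

Lemma ler_chain j k : (v j <= v k) = (j <= k)%N.
Proof. by rewrite leNgt ltr_chain -leqNgt. Qed.

Lemma chain_inj : injective v.
Proof.
by move=> j k jk; apply/val_inj/anti_leq; rewrite /= -!ler_chain jk lexx.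
Qed.

Lemma chain_ge0 k : 0 <= v k.
Proof.
have n0 : (0 < n)%N by apply: leq_ltn_trans (ltn_ord k).
by rewrite -(vP.1 (Ordinal n0) erefl) ler_chain.
Qed.

Lemma chain_le_length k : v k <= chain_length v.
Proof. exact: le_bigmax. Qed.

Lemma left_end_le A k : k \in A -> left_end v A <= v k.
Proof. by move=> kA; apply: bigmin_le_cond. Qed.

Lemma right_end_ge A k : k \in A -> v k <= right_end v A.
Proof. by move=> kA; rewrite /right_end; apply: le_bigmax_cond. Qed.

Lemma left_end_ex A : A != set0 -> exists2 k, k \in A & left_end v A = v k.
Proof.
case/set0Pn => j jA.
have [k kA kE] := @eq_bigmin _ _ _ (chain_length v) j (mem A) v jA
  (fun i _ => chain_le_length i).
by exists k.
Qed.

Lemma right_end_ex A : A != set0 -> exists2 k, k \in A & right_end v A = v k.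
Proof.
case/set0Pn => j jA.
have [k kA kE] := @eq_bigmax _ _ _ 0 j (mem A) v jA (fun i _ => chain_ge0 i).
by exists k.
Qed.

Lemma left_end_ge0 A : 0 <= left_end v A.
Proof.
by apply: le_bigmin => [|k _]; [apply: bigmax_ge_id | apply: chain_ge0].
Qed.

Lemma right_end_le_length A : right_end v A <= chain_length v.
Proof.
by apply: bigmax_le => [|k _]; [apply: bigmax_ge_id | apply: chain_le_length].
Qed.

Lemma left_le_right_end A : A != set0 -> left_end v A <= right_end v A.
Proof.
by case/set0Pn => k kA; apply: le_trans (left_end_le kA) (right_end_ge kA).
Qed.

Lemma extent_le A (x rho : R) : 0 <= rho ->
  (forall k, k \in A -> x <= v k <= x + rho) ->
  right_end v A - left_end v A <= rho.
Proof.
move=> rho0 Ax; have [->|A0] := eqVneq A set0.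
  rewrite /right_end /left_end !big_set0.
  have : 0 <= chain_length v by apply: bigmax_ge_id.
  lra.
have [k kA ->] := left_end_ex A0; have [j jA ->] := right_end_ex A0.
have := Ax k kA; have := Ax j jA; lra.
Qed.

(** * Left-induced partitions *)

(** Positions are distinct, so the minimiser is unique and [pick] can return no other. *)
Lemma next_anchorP (x : R) (b : 'I_n) :
  next_anchor v x = Some b <->
  x < v b /\ forall j, x < v j -> v b <= v j.
Proof.
rewrite /next_anchor; case: pickP => [k /andP[xk /forallP kmin]|nok].
  split=> [[<-]|[xb bmin]].
    by split=> // j xj; apply: (implyP (kmin j)).
  congr Some; apply/chain_inj/le_anti.
  by rewrite bmin // (implyP (kmin b)).
split=> // -[xb bmin].
have /negP[] := negbT (nok b); rewrite xb; apply/forallP => j.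
by apply/implyP => /bmin.
Qed.

Lemma next_anchor_None (x : R) :
  next_anchor v x = None <-> forall k, v k <= x.
Proof.
split=> [nx k|kx].
  rewrite leNgt; apply/negP => xk.
  have [b xb bmin] := @arg_minP _ _ _ k (fun j => x < v j) v xk.
  by have /next_anchorP : x < v b /\ (forall j, x < v j -> v b <= v j);
    [split | rewrite nx].
case nx: (next_anchor v x) => [b|//].
by move/next_anchorP: nx => [+ _]; rewrite ltNge kx.
Qed.

Lemma anchors_from_cons rho fuel a :
  anchors_from v rho fuel a = a :: behead (anchors_from v rho fuel a).
Proof. by case: fuel. Qed.

Lemma anchors_from_path rho fuel a :
  path (fun j k => v j + rho < v k) a (behead (anchors_from v rho fuel a)).
Proof.
elim: fuel a => [//|fuel IH] a /=.
case nx: (next_anchor _ _) => [b|//]; move/next_anchorP: nx => [ab _].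
by have := IH b; case: fuel IH => [|fuel] _ /=; rewrite ab.
Qed.

Lemma anchors_sorted rho : sorted (fun j k => v j + rho < v k) (anchors v rho).
Proof.
rewrite /anchors; case: pickP => [a _|//].
by rewrite anchors_from_cons; apply: anchors_from_path.
Qed.

(** Anchor indices strictly increase, so [n <= fuel + a] survives each unit of fuel spent; at fuel 0
    it contradicts [a < n]. *)
Lemma anchors_from_cover rho fuel a k : 0 <= rho -> (n <= fuel + a)%N ->
  v a <= v k ->
  exists2 b, b \in anchors_from v rho fuel a & v b <= v k <= v b + rho.
Proof.
move=> rho0; elim: fuel a => [|fuel IH] a na ak.
  by have := ltn_ord a; rewrite ltnNge na.
have [ka|ka] := leP (v k) (v a + rho).
  by exists a; [rewrite inE eqxx | rewrite ak].
rewrite /=; case nx: (next_anchor _ _) => [b|].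
  move/next_anchorP: nx => [ab bmin].
  have [|c cb kc] := IH b _ (bmin k ka); last first.
    by exists c; rewrite // inE cb orbT.
  have : v a < v b by lra.
  rewrite ltr_chain; lia.
by move/next_anchor_None: nx => /(_ k); rewrite leNgt ka.
Qed.

Lemma anchors_cover rho k : 0 <= rho ->
  exists2 b, b \in anchors v rho & v b <= v k <= v b + rho.
Proof.
move=> rho0; rewrite /anchors; case: pickP => [a /eqP a0|no0].
  by apply: anchors_from_cover => //; rewrite ?leq_addr // vP.1 ?chain_ge0.
have n0 : (0 < n)%N by apply: leq_ltn_trans (ltn_ord k).
by have := no0 (Ordinal n0); rewrite eqxx.
Qed.

(** For [0 <= rho] the gap relation is transitive, so it passes from consecutive anchors to all
    pairs. *)
Lemma anchors_gap rho x0 (i j : nat) : 0 <= rho ->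
  (i < j < size (anchors v rho))%N ->
  v (nth x0 (anchors v rho) i) + rho < v (nth x0 (anchors v rho) j).
Proof.
move=> rho0 /andP[ij js].
have tr : transitive (fun j k : 'I_n => v j + rho < v k).
  by move=> y x z; lra.
have := sorted_ltn_nth tr x0 (anchors_sorted rho).
by apply; rewrite ?inE // (ltn_trans ij).
Qed.

(** Wrapping the anchors in [Some] makes the default [None] stand for the padded empty clusters,
    without a default viewpoint. *)
Lemma pad_left_inducedP m rho (i : 'I_m) k :
  reflect (exists2 a, nth None [seq Some a | a <- anchors v rho] i = Some a
             & v a <= v k <= v a + rho)
          (k \in pad (left_induced v rho) i).
Proof.
rewrite /pad /left_induced.
have [ia|ia] := ltnP i (size (anchors v rho)); last first.
  rewrite !nth_default ?size_map // inE; constructor; by case.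
have a0 : 'I_n by case: (anchors v rho) ia.
rewrite !(nth_map a0) // inE; apply: (iffP idP) => [h|[a [<-]]//].
by exists (nth a0 (anchors v rho) i).
Qed.

Lemma left_induced_partition m rho : 0 <= rho ->
  (size (anchors v rho) <= m)%N ->
  m_partition (pad (m := m) (left_induced v rho)).
Proof.
move=> rho0 sm; split=> [i j ij|].
  rewrite -setI_eq0; apply/set0Pn => -[k /setIP[/pad_left_inducedP[a ia ka]]].
  move=> /pad_left_inducedP[b jb kb].
  wlog ltij : i j a b ij ia jb ka kb / (i < j)%N.
    move=> W; have [lt|lt|/val_inj E] := ltngtP i j; first exact: (W i j a b).
      by apply: (W j i b a); rewrite // eq_sym.
    by rewrite E eqxx in ij.
  have js : (j < size (anchors v rho))%N.
    by rewrite ltnNge; apply/negP => h; move: jb; rewrite nth_default ?size_map.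
  move: ia jb; rewrite !(nth_map a) ?(ltn_trans ltij) // => -[ia] [jb].
  have := @anchors_gap rho a i j rho0; rewrite ltij js ia jb => /(_ isT).
  lra.
apply/setP => k; rewrite inE; apply/bigcupP.
have [b bs kb] := anchors_cover k rho0.
have im : (index b (anchors v rho) < m)%N.
  by apply: leq_trans sm; rewrite index_mem.
exists (Ordinal im) => //; apply/pad_left_inducedP; exists b => //.
by rewrite (nth_map b) ?index_mem // nth_index.
Qed.

Lemma left_induced_dimension m rho : 0 <= rho ->
  dimension v (pad (m := m) (left_induced v rho)) <= rho.
Proof.
move=> rho0; apply: bigmax_le => // i _.
have [->|/set0Pn[k /pad_left_inducedP[a ia _]]] :=
  eqVneq (pad (left_induced v rho) i) set0.
  by apply: (@extent_le _ 0) => // k; rewrite inE.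
apply: (@extent_le _ (v a)) => // j /pad_left_inducedP[b].
by rewrite ia => -[<-].
Qed.

(** * Number of anchors and the minimum dimension *)

Lemma anchors_value rho x0 i : 0 <= rho -> (i < size (anchors v rho))%N ->
  i%:R * rho <= v (nth x0 (anchors v rho) i).
Proof.
move=> rho0; elim: i => [|i IH] ia; first by rewrite mul0r chain_ge0.
have := @anchors_gap rho x0 i i.+1 rho0; rewrite ltnSn ia => /(_ isT).
have := IH (ltnW ia); rewrite -natr1; lra.
Qed.

(** Anchor number [m], counted from 0, would lie strictly beyond [m] steps of length [v_n / m],
    hence beyond the end of the chain. *)
Lemma size_anchors_mean m : (0 < m)%N ->
  (size (anchors v (chain_length v / m%:R)) <= m)%N.
Proof.
move=> m0; set rho := _ / _.
have rho0 : 0 <= rho by rewrite divr_ge0 //; apply: bigmax_ge_id.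
rewrite leqNgt; apply/negP => ms.
have x0 : 'I_n by case: (anchors v rho) ms.
have m1 : (m.-1 < m)%N by rewrite prednK.
have := @anchors_gap rho x0 m.-1 m rho0; rewrite m1 ms => /(_ isT).
have := @anchors_value rho x0 m.-1 rho0 (ltn_trans m1 ms).
have := chain_le_length (nth x0 (anchors v rho) m).
have : m.-1%:R * rho + rho = chain_length v.
  rewrite -[X in _ + X]mul1r -mulrDl natr1 prednK // mulrC divfK //.
  by rewrite pnatr_eq0 -lt0n.
lra.
Qed.

Lemma optimal_dimension_le m (V : 'I_m -> {set 'I_n}) : (0 < m)%N ->
  optimal_partition v V -> dimension v V <= chain_length v / m%:R.
Proof.
move=> m0 [_ Vmin].
have rho0 : 0 <= chain_length v / m%:R.
  by rewrite divr_ge0 //; apply: bigmax_ge_id.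
apply: le_trans (Vmin _ (left_induced_partition rho0 (size_anchors_mean m0))) _.
exact: left_induced_dimension.
Qed.

Lemma optimal_size_anchors m (V : 'I_m -> {set 'I_n}) rho : 0 <= rho ->
  optimal_partition v V -> rho < dimension v V ->
  (m < size (anchors v rho))%N.
Proof.
move=> rho0 [_ Vmin] rhoV; rewrite ltnNge; apply/negP => sm.
have := Vmin _ (left_induced_partition rho0 sm).
by have := @left_induced_dimension m _ rho0; lra.
Qed.

(** * Shape of the partition returned by the bisection *)

Lemma bisection_while_left_induced m eps
    (s s' : bisection_state R {set 'I_n}) c :
  while (bisection_guard eps)
    (bisection_body (fun rho => ret (left_induced v rho)) m) s s' c ->
  (forall P, s.2 = Some P -> exists rho, P = left_induced v rho) ->
  forall P, s'.2 = Some P -> exists rho, P = left_induced v rho.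
Proof.
elim=> // -[[[a b] rho] best] s1 d _ _ IH Hs; apply: IH.
rewrite /bisection_body /=; case: ifP => _ P /=; first exact: Hs.
by case=> <-; exists rho.
Qed.

(** The stored partition is always left-induced, and such a cluster is cut out by one interval
    starting at its anchor. Hence a robot sweeping from end to end meets only its own viewpoints. *)
Lemma bisection_partition_convex m eps (V : 'I_m -> {set 'I_n}) i k :
  bisection_partition v eps V ->
  (k \in V i) = (V i != set0) && (left_end v (V i) <= v k <= right_end v (V i)).
Proof.
case=> P [c [[a [b [rho [c' [W _]]]]] VP]].
have [|r PE] := bisection_while_left_induced W _ (erefl (Some P)); first by [].
apply/idP/idP => [kV|/and3P[V0 lk kr]].
  rewrite left_end_le ?right_end_ge // !andbT.
  by apply/set0Pn; exists k.
have [j jV lE] := left_end_ex V0; have [h hV rE] := right_end_ex V0.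
move: jV hV; rewrite lE in lk; rewrite rE in kr; rewrite VP PE.
move=> /pad_left_inducedP[x ix jx] /pad_left_inducedP[y iy hy].
apply/pad_left_inducedP; exists x => //.
by move: iy; rewrite ix => -[xy]; rewrite -xy in hy; lra.
Qed.

End Chain.

(** * Lower bound on the refresh time *)

Lemma within_continuous_sub (R : realType) (f : R -> R) (a b c d : R) :
  a <= c -> d <= b -> {within `[a, b], continuous f}%classic ->
  {within `[c, d], continuous f}%classic.
Proof.
move=> ac db; apply: continuous_subspaceW => t /=; rewrite !in_itv /=; lra.
Qed.

(** Induction on the exceptional times: split the interval at one that is interior, drop it
    otherwise, and use the mean value theorem when none is left. *)
Lemma piecewise_lipschitz (R : realType) (f : R -> R) (s : seq R) (a b : R) :
  a <= b -> {within `[a, b], continuous f}%classic ->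
  (forall t, a < t < b -> t \notin s ->
     derivable f t 1 /\ `|f^`()%classic t| <= 1) ->
  `|f b - f a| <= b - a.
Proof.
elim: s a b => [|c s IH] a b ab cf df.
  have [->|neab] := eqVneq a b; first by rewrite !subrr normr0.
  have ltab : a < b by rewrite lt_neqAle neab.
  have [t|t tab ->] := MVT ltab _ cf (df := f^`()%classic).
    rewrite in_itv /= => tab; have [dt _] := df t tab isT.
    by rewrite derive1E; apply: derivableP.
  rewrite in_itv /= in tab; have [_ dt] := df t tab isT.
  rewrite normrM (ger0_norm (_ : 0 <= b - a)); last by lra.
  by rewrite ler_piMl; lra.
have [/andP[ac cb]|ncab] := boolP (a < c < b); last first.
  apply: IH => // t tab ts; apply: df => //.
  by rewrite inE negb_or ts andbT; apply: contraNneq ncab => <-.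
have H1 : `|f c - f a| <= c - a.
  apply: IH => [||t tac ts]; [exact: ltW| |apply: df; rewrite ?inE].
  - by apply: within_continuous_sub cf => //; apply: ltW.
  - by apply/andP; split; lra.
  - by rewrite negb_or ts andbT lt_eqF //; lra.
have H2 : `|f b - f c| <= b - c.
  apply: IH => [||t tcb ts]; [exact: ltW| |apply: df; rewrite ?inE].
  - by apply: within_continuous_sub cf => //; apply: ltW.
  - by apply/andP; split; lra.
  - by rewrite negb_or ts andbT gt_eqF //; lra.
have -> : f b - f a = (f b - f c) + (f c - f a) by lra.
by have := ler_normD (f b - f c) (f c - f a); lra.
Qed.

Lemma robot_trajectory_lipschitz (R : realType) (Tf len : R) (x : R -> R) s t :
  robot_trajectory Tf len x -> 0 <= s <= Tf -> 0 <= t <= Tf ->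
  `|x t - x s| <= `|t - s|.
Proof.
case=> cx _ [e dx].
wlog st : s t / s <= t.
  move=> W hs ht; have [/W|/ltW/W] := leP s t; first exact.
  by move=> /(_ ht hs); rewrite distrC (distrC t).
move=> /andP[s0 _] /andP[_ tT]; rewrite [X in _ <= X]ger0_norm ?subr_ge0 //.
apply: (@piecewise_lipschitz _ _ e) => //.
  exact: within_continuous_sub cx.
by move=> u /andP[su ut]; apply: dx; apply/andP; split; lra.
Qed.

Section RefreshTime.
Variables (R : realType) (n m : nat) (v : 'I_n -> R) (Tf : R).
Variable (Y : 'I_m -> R -> R).

Lemma refresh_time_ge0 : 0 <= refresh_time v Tf Y.
Proof. exact: bigmax_ge_id. Qed.

(** Ensures that [sup] in the refresh time is a true upper bound and not a default value. *)
Lemma Omega_has_ubound (p : R) :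
  has_ubound [set t.2 - t.1 | t in Omega Tf Y p]%classic.
Proof. by exists Tf => _ [t [t1 t2 _ _] <-]; lra. Qed.

Lemma refresh_time_ge k (t1 t2 : R) : Omega Tf Y (v k) (t1, t2) ->
  t2 - t1 <= refresh_time v Tf Y.
Proof.
move=> tO; apply: le_trans (le_bigmax _ _ k).
by apply: (ub_le_sup (Omega_has_ubound (v k))); exists (t1, t2).
Qed.

Lemma refresh_time_le (d : R) : 0 <= Tf -> 0 <= d ->
  (forall k t1 t2, Omega Tf Y (v k) (t1, t2) -> t2 - t1 <= d) ->
  refresh_time v Tf Y <= d.
Proof.
move=> T0 d0 Hd; apply: bigmax_le => // k _; apply: ge_sup.
  (* A degenerate interval has empty interior, so it witnesses nonemptiness. *)
  exists (0 - 0); exists (0, 0) => //.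
  by split=> //=; rewrite ?lexx // => i s; lra.
by move=> _ [[t1 t2] tO <-]; apply: Hd tO.
Qed.

(** Otherwise the window of radius [rho] around [t] would be a gap of length [2 * rho] between
    visits. *)
Lemma refresh_time_visit k (rho t : R) : refresh_time v Tf Y < 2 * rho ->
  rho <= t <= Tf - rho ->
  exists i, exists2 s, `|s - t| < rho & Y i s = v k /\ 0 <= s <= Tf.
Proof.
move=> RT tT; apply: contrapT => nov.
have rho0 : 0 <= rho by have := refresh_time_ge0; lra.
suff /refresh_time_ge : Omega Tf Y (v k) (t - rho, t + rho) by lra.
split=> /= [|||i s /andP[s1 s2]]; rewrite ?ler_norm.
- by apply/andP; split; lra.
- by apply/andP; split; lra.
- lra.
apply/eqP => Yis; apply: nov; exists i; exists s.
  by rewrite ltr_norml; apply/andP; split; lra.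
by split=> //; apply/andP; split; lra.
Qed.

(* The robots may exchange their order, so the robots near the first [j]
   anchors are only counted, not identified. *)
Lemma card_robots_left_of_anchor (rho : R) (a : nat -> 'I_n) (N : nat) :
  team_trajectory v Tf Y -> refresh_time v Tf Y < 2 * rho ->
  (forall j, (j.+1 < N)%N -> v (a j) + rho < v (a j.+1)) ->
  forall j, (j < N)%N -> forall t, j.+1%:R * rho <= t <= Tf - j.+1%:R * rho ->
  (j < #|[set i : 'I_m | (Y i t <= v (a j) + rho)%R]%SET|)%N.
Proof.
move=> YT RT gap; have rho0 : 0 <= rho by have := refresh_time_ge0; lra.
elim=> [|j IH] jN t tT.
  have := @refresh_time_visit (a 0) rho t RT; rewrite !mul1r in tT.
  move=> /(_ tT)[i [s st [Yis sT]]].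
  apply/card_gt0P; exists i; rewrite inE.
  have tT' : 0 <= t <= Tf by apply/andP; split; lra.
  have := robot_trajectory_lipschitz (YT i) sT tT'.
  rewrite (distrC t) Yis; have := ler_norm (Y i t - v (a 0)); lra.
rewrite -natr1 mulrDl mul1r in tT.
have j0 : 0 <= j.+1%:R * rho by rewrite mulr_ge0.
have tT' : 0 <= t <= Tf by apply/andP; split; lra.
have [|i [s st [Yis sT]]] := @refresh_time_visit (a j.+1) rho t RT.
  by apply/andP; split; lra.
move: (st); rewrite ltr_norml => st'.
(* The visit is less than [rho] away from [t], so the previous, wider time range contains it. *)
have /(IH (ltnW jN)) cs : j.+1%:R * rho <= s <= Tf - j.+1%:R * rho.
  by apply/andP; split; lra.
have gj := gap j jN.
have iN : i \notin [set i : 'I_m | (Y i s <= v (a j) + rho)%R]%SET.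
  by rewrite inE -ltNge Yis.
have : (j.+1 < #|i |: [set i : 'I_m | (Y i s <= v (a j) + rho)%R]%SET|)%N.
  by rewrite cardsU1 iN.
(* At time [s] the visitor and all robots already counted are at most at [v (a j.+1)]; until [t]
   they move by less than [rho]. *)
move/leq_trans; apply; apply/subset_leq_card/fintype.subsetP => h.
rewrite !inE => hs.
have Yhs : Y h s <= v (a j.+1).
  by case/orP: hs => [/eqP ->|]; [rewrite Yis | lra].
have := robot_trajectory_lipschitz (YT h) sT tT'.
rewrite (distrC t); have := ler_norm (Y h t - Y h s); lra.
Qed.

Lemma refresh_time_lower_bound (V : 'I_m -> {set 'I_n}) :
  chain v -> (0 < m)%N -> 4 * chain_length v <= Tf ->
  optimal_partition v V -> team_trajectory v Tf Y ->
  2 * dimension v V <= refresh_time v Tf Y.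
Proof.
move=> vP m0 CT Vopt YT; rewrite leNgt; apply/negP => RT.
have RT0 := refresh_time_ge0.
set d := dimension v V in RT.
(* The midpoint of half the refresh time and [d] lies strictly between them. *)
pose rho := (refresh_time v Tf Y / 2 + d) / 2.
have rhod : rho < d by rewrite /rho; lra.
have RTrho : refresh_time v Tf Y < 2 * rho by rewrite /rho; lra.
have rho0 : 0 <= rho by lra.
have sm := optimal_size_anchors vP rho0 Vopt rhod.
have x0 : 'I_n by case: (anchors v rho) sm.
have gap j : (j.+1 < m.+1)%N ->
    v (nth x0 (anchors v rho) j) + rho < v (nth x0 (anchors v rho) j.+1).
  move=> jm; apply: anchors_gap => //.
  by rewrite ltnSn /=; apply: leq_ltn_trans sm.
have dm : d * m%:R <= chain_length v.
  by rewrite -ler_pdivlMr ?ltr0n // optimal_dimension_le.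
have d_le : d <= chain_length v.
  apply: le_trans dm; rewrite ler_peMr ?ler1n //; lra.
(* [m * d] and [d] are each at most [v_n], and [2 * v_n <= Tf / 2]; thus time [Tf / 2] is in the
   range for [m.+1] anchors. *)
have mT : m.+1%:R * rho <= Tf / 2.
  have : m.+1%:R * rho <= m.+1%:R * d by rewrite ler_wpM2l // ltW.
  rewrite -[X in X * d]natr1; lra.
have := card_robots_left_of_anchor YT RTrho gap (ltnSn m) (t := Tf / 2).
have -> : m.+1%:R * rho <= Tf / 2 <= Tf - m.+1%:R * rho.
  by apply/andP; split; lra.
by move=> /(_ isT); rewrite ltnNge -[X in (_ <= X)%N]card_ord max_card.
Qed.

End RefreshTime.

(** * Zigzag trajectories *)

Section Zigzag.
Variables (R : realType) (l r : R).
Hypothesis lr : l < r.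
Local Notation d := (r - l).

Lemma zigzag_periodic (j : int) (p : R) : 0 <= p <= d ->
  zigzag l r (p + j%:~R * (2 * d)) = l + p.
Proof.
move=> pd; have d_gt0 : 0 < d by rewrite subr_gt0.
rewrite /zigzag gt_eqF //.
have -> : Num.floor ((p + j%:~R * (2 * d)) / (2 * d)) = j.
  apply: floor_def; rewrite intrD.
  rewrite ler_pdivlMr ?ltr_pdivrMr ?mulr_gt0 //.
  by apply/andP; split; lra.
rewrite addrK min_l //; lra.
Qed.

(** With [zigzag_le_dist] this shows that [zigzag l r t - l] is the distance from [t] to the
    multiples of [2 * d]: attained here, minimal there. The nearest multiple is the one just below
    [t] or the next. *)
Lemma zigzag_dist (t : R) :
  exists j : int, zigzag l r t = l + `|t - j%:~R * (2 * d)|.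
Proof.
have d_gt0 : 0 < d by rewrite subr_gt0.
rewrite /zigzag gt_eqF //; set k := Num.floor _.
have /andP[] := floor_itv (t / (2 * d)); rewrite -/k intrD.
rewrite ler_pdivlMr ?ltr_pdivrMr ?mulr_gt0 // => kt tk.
set s := t - _; have s0 : 0 <= s by rewrite /s; lra.
have [sd|sd] := leP s (2 * d - s).
  by exists k; rewrite -/s ger0_norm.
exists (k + 1); rewrite intrD ler0_norm; rewrite /s; lra.
Qed.

Lemma zigzag_le_dist (t : R) (j : int) :
  zigzag l r t <= l + `|t - j%:~R * (2 * d)|.
Proof.
have d_gt0 : 0 < d by rewrite subr_gt0.
rewrite /zigzag gt_eqF //; set k := Num.floor _.
have /andP[] := floor_itv (t / (2 * d)); rewrite -/k intrD.
rewrite ler_pdivlMr ?ltr_pdivrMr ?mulr_gt0 // => kt tk.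
rewrite lerD2l ge_min; apply/orP.
have [jk|kj] := leP j k.
  left; have : j%:~R * (2 * d) <= k%:~R * (2 * d).
    by rewrite ler_pM2r ?mulr_gt0 // ler_int.
  by have := ler_norm (t - j%:~R * (2 * d)); lra.
right; have : (k + 1)%:~R * (2 * d) <= j%:~R * (2 * d).
  by rewrite ler_pM2r ?mulr_gt0 // ler_int lezD1.
rewrite intrD.
by have := ler_norm (j%:~R * (2 * d) - t); rewrite distrC; lra.
Qed.

(** Distance to a set is 1-Lipschitz: the multiple nearest to [s] also bounds the distance at
    [t]. *)
Lemma zigzag_lipschitz (s t : R) : `|zigzag l r t - zigzag l r s| <= `|t - s|.
Proof.
wlog st : s t / zigzag l r s <= zigzag l r t.
  move=> W; have [/W//|/ltW/W] := leP (zigzag l r s) (zigzag l r t).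
  by rewrite distrC (distrC t).
rewrite ger0_norm ?subr_ge0 //.
have [j zs] := zigzag_dist s; have zt := zigzag_le_dist t j.
have := ler_normD (t - s) (s - j%:~R * (2 * d)).
by rewrite addrA subrK; lra.
Qed.

Lemma zigzag_bounds (t : R) : l <= zigzag l r t <= r.
Proof.
have [j zt] := zigzag_dist t; rewrite zt lerDl normr_ge0 /= -zt.
have d_gt0 : 0 < d by rewrite subr_gt0.
rewrite /zigzag gt_eqF //; set s := t - _.
by have [sd|sd] := leP s (2 * d - s); lra.
Qed.

Lemma zigzag_derivable (Tf : R) : exists e : seq R,
  forall t, 0 < t < Tf -> t \notin e ->
    derivable (zigzag l r) t 1 /\ `|(zigzag l r)^`()%classic t| <= 1.
Proof.
(* The turning times up to [Tf]; away from them the motion is locally affine of slope 1 or -1. *)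
exists [seq i%:R * d | i <- iota 0 (Num.truncn (Tf / d)).+1].
have d_gt0 : 0 < d by rewrite subr_gt0.
move=> t /andP[t0 tT] te.
have td0 : 0 <= t / d by rewrite divr_ge0 // ltW.
have /andP[] := truncn_itv td0.
have [j jE] : {j | Num.truncn (t / d) = j} by exists (Num.truncn (t / d)).
rewrite jE.
rewrite ler_pdivlMr // ltr_pdivrMr // => jt tj.
have {}jt : j%:R * d < t.
  rewrite lt_neqAle jt andbT; apply: contraNneq te => <-.
  apply/mapP; exists j => //; rewrite mem_iota /= add0n ltnS -jE.
  by apply: le_truncn; rewrite ler_pM2r ?invr_gt0 // ltW.
suff [f fE [e e1 df]] : exists2 f : R -> R,
    {near t, f =1 zigzag l r} & exists2 e : R, `|e| <= 1 & is_derive t 1 f e.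
  have [dz ez] := near_eq_is_derive fE df.
  by split=> //; rewrite derive1E ez.
have near_t : \forall u \near t, j%:R * d <= u <= j.+1%:R * d.
  near=> u; apply/andP; split; apply: ltW; near: u.
    exact: lt_nbhsr.
  exact: lt_nbhsl.
(* The parity of [j] decides between the rising and the falling branch. *)
have [i ji] : exists i, j = (2 * i)%N \/ j = (2 * i).+1.
  by exists j./2; have := odd_double_half j; case: odd; lia.
case: ji => ij; rewrite ij in near_t.
  exists (fun u => l + (u - (2 * i)%:R * d)).
    by near=> u; rewrite (@zigzag_up _ _ _ _ i lr) //; near: u.
  by exists 1; [rewrite normr1 | apply: is_derive_eq; ring].
exists (fun u => r - (u - (2 * i).+1%:R * d)).
  by near=> u; rewrite (@zigzag_down _ _ _ _ i lr) //; near: u.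
by exists (-1); [rewrite normrN normr1 | apply: is_derive_eq; ring].
Unshelve. all: by end_near.
Qed.

End Zigzag.

Lemma zigzag_id (R : realType) (l t : R) : zigzag l l t = l.
Proof. by rewrite /zigzag subrr eqxx. Qed.

Lemma robot_trajectory_cst (R : realType) (Tf len p : R) : 0 <= p <= len ->
  robot_trajectory Tf len (fun=> p).
Proof.
move=> pl; split=> //.
  by apply: continuous_subspaceT; apply: cst_continuous.
exists [::] => t _ _; split; first exact: derivable_cst.
by rewrite derive1_cst normr0.
Qed.

Lemma robot_trajectory_zigzag (R : realType) (Tf len l r : R) :
  0 <= l -> l <= r -> r <= len -> robot_trajectory Tf len (zigzag l r).
Proof.
move=> l0; rewrite le_eqVlt => /predU1P[<- l_len|lr r_len].
  have -> : zigzag l l = fun=> l by apply/funext => t; apply: zigzag_id.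
  by apply: robot_trajectory_cst; rewrite l0.
split; last exact: zigzag_derivable.
  apply: continuous_subspaceT => t; apply/cvgrPdist_lt => e e0; near=> u.
  apply: le_lt_trans (zigzag_lipschitz lr u t) _.
  by near: u; apply/nbhs_ballP; exists e.
by move=> t _; have := zigzag_bounds lr t; lra.
Unshelve. all: by end_near.
Qed.

(** * Image and refresh time of the team trajectory of a partition *)

Section PartitionTrajectory.
Variables (R : realType) (n m : nat) (v : 'I_n -> R) (Tf : R).
Variables (V : 'I_m -> {set 'I_n}) (park : 'I_m -> R).
Hypothesis vP : chain v.
Hypothesis length_le : 4 * chain_length v <= Tf.
Hypothesis V_convex : forall i k, (k \in V i) =
  (V i != set0) && (left_end v (V i) <= v k <= right_end v (V i)).
Hypothesis parkP : forall i : 'I_m, V i = set0 ->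
  0 <= park i <= chain_length v /\ forall k : 'I_n, park i != v k.
Local Notation X := (partition_trajectory v V park).
Local Notation l i := (left_end v (V i)).
Local Notation r i := (right_end v (V i)).

Lemma partition_team_trajectory : team_trajectory v Tf X.
Proof.
move=> i; rewrite /partition_trajectory.
have [V0|V0] := eqVneq (V i) set0.
  by apply: robot_trajectory_cst; case: (parkP V0).
apply: robot_trajectory_zigzag; first exact: left_end_ge0.
  exact: left_le_right_end.
exact: right_end_le_length.
Qed.

Lemma partition_visits i k (t1 t2 : R) : k \in V i ->
  t1 < t2 -> 2 * (r i - l i) < t2 - t1 ->
  exists2 s, t1 < s < t2 & X i s = v k.
Proof.
move=> kV; rewrite /partition_trajectory.
have V0 : V i != set0 by apply/set0Pn; exists k.
rewrite (negbTE V0) => t12; have := left_le_right_end v V0.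
have /andP[] : l i <= v k <= r i by move: kV; rewrite V_convex V0.
move: (l i) (r i) => a b ak kb; rewrite le_eqVlt => /predU1P[ab _|ab dt].
  exists ((t1 + t2) / 2); first by apply/andP; split; lra.
  by rewrite -ab zigzag_id; apply: le_anti; lra.
have d0 : 0 < 2 * (b - a) by lra.
have p_ab : 0 <= v k - a <= b - a by apply/andP; split; lra.
(* Selects the first rising passage through [v k] strictly after [t1]; it comes at most one period
   later. *)
pose j := Num.floor ((t1 - (v k - a)) / (2 * (b - a))) + 1.
have := floor_itv ((t1 - (v k - a)) / (2 * (b - a))).
rewrite intrD ler_pdivlMr // ltr_pdivrMr // => /andP[j1 j2].
exists (v k - a + j%:~R * (2 * (b - a))); last first.
  by rewrite zigzag_periodic // addrC subrK.
by rewrite intrD; apply/andP; split; lra.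
Qed.

Lemma partition_image : image_of v Tf X =1 V.
Proof.
move=> i; apply/setP => k; rewrite inE; apply/asboolP/idP => [[t [tT]]|kV].
  rewrite /partition_trajectory; have [V0|V0] := eqVneq (V i) set0.
    by move=> E; have [_ /(_ k)] := parkP V0; rewrite E eqxx.
  move=> E; rewrite V_convex V0 -E /=.
  have := left_le_right_end v V0; rewrite le_eqVlt => /predU1P[<-|lr].
    by rewrite zigzag_id lexx.
  exact: zigzag_bounds.
have V0 : V i != set0 by apply/set0Pn; exists k.
have lenT := length_le; have rlen := right_end_le_length v (V i).
have l0 := left_end_ge0 vP (V i).
have := kV; rewrite V_convex V0 /= => /andP[lk kr].
(* The passage during the first ascent. *)
exists (v k - l i); split; first by apply/andP; split; lra.
rewrite /partition_trajectory (negbTE V0).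
have := left_le_right_end v V0; rewrite le_eqVlt => /predU1P[E|lr].
  by rewrite -E zigzag_id; apply: le_anti; rewrite lk E.
have := @zigzag_periodic _ _ _ lr 0 (v k - l i).
rewrite mul0r addr0 => ->; first by lra.
by apply/andP; split; lra.
Qed.

(** Above: the robot owning a viewpoint meets it in every window longer than its period. Below: the
    left end of cluster [i] is unvisited during [(0, 2 d_i)], since robot [i] is strictly above it
    and the other robots never go there, by disjointness of the images. *)
Lemma partition_refresh_time : m_partition V ->
  refresh_time v Tf X = 2 * dimension v V.
Proof.
move=> [Vdisj Vcover]; apply: le_anti; apply/andP; split.
  have D0 : 0 <= dimension v V by apply: bigmax_ge_id.
  have len0 : 0 <= chain_length v by apply: bigmax_ge_id.
  have lenT := length_le.
  apply: refresh_time_le => [||k t1 t2 [/= t1T t2T t12 nov]]; try lra.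
  have : k \in \bigcup_(i < m) V i by rewrite Vcover inE.
  case/bigcupP => i _ kV; rewrite leNgt; apply/negP => dt.
  have : r i - l i <= dimension v V.
    by apply: (@le_bigmax _ _ _ _ (fun i => r i - l i)).
  move=> diD; have [||s st Xs] := @partition_visits i k t1 t2 kV; [lra|lra|].
  by have := nov i s st; rewrite Xs eqxx.
rewrite -ler_pdivlMl //; apply: bigmax_le => [|i _].
  by rewrite mulr_ge0 ?invr_ge0 // refresh_time_ge0.
rewrite ler_pdivlMl //.
have [lr|rl] := ltP (l i) (r i); last first.
  by have := refresh_time_ge0 v Tf X; lra.
have V0 : V i != set0.
  apply: contraTneq lr => ->; rewrite /left_end /right_end !big_set0 -leNgt.
  exact: bigmax_ge_id.
have lenT := length_le; have rlen := right_end_le_length v (V i).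
have l0 := left_end_ge0 vP (V i).
have [k kV lE] := left_end_ex v V0.
have -> : 2 * (r i - l i) = 2 * (r i - l i) - 0 by rewrite subr0.
apply: (@refresh_time_ge _ _ _ _ _ _ k).
split=> /=; [by apply/andP; split; lra..|lra|].
move=> j s /andP[s0 sd]; apply/eqP => Xjs.
have [ji|ji] := eqVneq j i; last first.
  have : k \in V j.
    rewrite -partition_image inE; apply/asboolP; exists s; split=> //.
    by apply/andP; split; lra.
  by move=> kVj; have /pred0P/(_ k) := Vdisj _ _ ji; rewrite /= kVj kV.
move: Xjs; rewrite ji /partition_trajectory (negbTE V0) -lE.
have [sm|sm] := leP s (r i - l i).
  have := @zigzag_periodic _ _ _ lr 0 s; rewrite mul0r addr0 => ->; first lra.
  by apply/andP; split; lra.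
have := @zigzag_down _ (l i) (r i) s 0 lr; rewrite mul1r => ->; first lra.
by apply/andP; split; lra.
Qed.

End PartitionTrajectory.

(** * Scanning the viewpoints *)

Section Scan.
Variables (R : realType) (n : nat) (v : 'I_n -> R).
Implicit Types (rho x : R) (a k : 'I_n) (s : seq 'I_n) (P : seq (seq 'I_n)).

(** Per viewpoint: one access, one addition, one comparison and at most two list operations. *)
Lemma scan_from_time rho x s : ((scan_from v rho x s).2 <= 5 * size s + 1)%N.
Proof.
elim: s x => [//|k s IH] x /=; case: ifP => _.
  by have := IH x; case: (scan_from _ _ _ _) => [[c cs] t] /=; lia.
by have := IH (v k); case: (scan_from _ _ _ _) => [[c cs] t] /=; lia.
Qed.

Lemma scan_time rho : ((scan v rho).2 <= 5 * n + 1)%N.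
Proof.
rewrite /scan; have := size_enum_ord n.
case: (enum 'I_n) => [|k s] /= sn; first lia.
have := scan_from_time rho (v k) s.
by case: (scan_from _ _ _ _) => [[c cs] t] /=; lia.
Qed.

(** The scan only cuts its input. Cluster count, order inside clusters and total length all follow
    from this. *)
Lemma scan_from_flatten rho x s :
  (scan_from v rho x s).1.1 ++ flatten (scan_from v rho x s).1.2 = s.
Proof.
elim: s x => [//|k s IH] x /=; case: ifP => _.
  by have := IH x; case: (scan_from _ _ _ _) => [[c cs] t] /= ->.
by have := IH (v k); case: (scan_from _ _ _ _) => [[c cs] t] /= ->.
Qed.

Lemma scan_flatten rho : flatten (scan v rho).1 = enum 'I_n.
Proof.
rewrite /scan; case: (enum 'I_n) => [|k s] //=.
have := scan_from_flatten rho (v k) s.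
by case: (scan_from _ _ _ _) => [[c cs] t] /= ->.
Qed.

Lemma scan_from_nonempty rho x s : [::] \notin (scan_from v rho x s).1.2.
Proof.
elim: s x => [//|k s IH] x /=; case: ifP => _.
  by have := IH x; case: (scan_from _ _ _ _) => [[c cs] t].
by have := IH (v k); case: (scan_from _ _ _ _) => [[c cs] t].
Qed.

Lemma scan_nonempty rho : [::] \notin (scan v rho).1.
Proof.
rewrite /scan; case: (enum 'I_n) => [|k s] //=.
have := scan_from_nonempty rho (v k) s.
by case: (scan_from _ _ _ _) => [[c cs] t].
Qed.

Lemma enum_ord_sorted : sorted (fun j k : 'I_n => (j < k)%N) (enum 'I_n).
Proof.
have := iota_ltn_sorted 0 n.
by rewrite -val_enum_ord sorted_map.
Qed.

Lemma size_flatten_nonempty (T : eqType) (ss : seq (seq T)) :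
  [::] \notin ss -> (size ss <= size (flatten ss))%N.
Proof.
elim: ss => [//|[//|x s] ss IH] /=; rewrite inE /= size_cat => /IH; lia.
Qed.

Lemma size_scan rho : (size (scan v rho).1 <= n)%N.
Proof.
have := size_flatten_nonempty (scan_nonempty rho).
by rewrite scan_flatten size_enum_ord.
Qed.

Lemma scan_cluster_sorted rho s : s \in (scan v rho).1 ->
  sorted (fun j k : 'I_n => (j < k)%N) s.
Proof.
move=> sP; apply: (@subseq_sorted _ _ _ s (enum 'I_n)) enum_ord_sorted.
  by move=> y x z; apply: ltn_trans.
rewrite -(scan_flatten rho); case/splitPr: sP => p1 p2.
rewrite flatten_cat /=; apply: subseq_trans (suffix_subseq _ _).
exact: prefix_subseq.
Qed.

(** * Agreement of the scan with the left-induced partition *)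

Hypothesis vP : chain v.

Lemma enum_ord_cat pre k s : enum 'I_n = pre ++ k :: s ->
  (forall j, j \in pre -> (j < k)%N) /\ (forall j, j \in s -> (k < j)%N).
Proof.
move=> E; have := enum_ord_sorted; rewrite E sorted_pairwise; last first.
  by move=> y x z; apply: ltn_trans.
rewrite pairwise_cat /= => /and3P[/allrelP prek _ /andP[/allP ks _]].
by split=> j jp; [apply: prek; rewrite ?inE ?eqxx | apply: ks].
Qed.

Lemma enum_ord_cluster rho pre k s : 0 <= rho -> enum 'I_n = pre ++ k :: s ->
  [set j in k :: [seq j <- s | v j <= v k + rho]]%SET =
  [set j | v k <= v j <= v k + rho]%SET.
Proof.
move=> rho0 E; have [prek ks] := enum_ord_cat E.
apply/setP => j; rewrite !inE mem_filter.
have : j \in pre ++ k :: s by rewrite -E mem_enum.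
rewrite mem_cat inE => /or3P[jp|/eqP ->|js].
- have jk := prek j jp; rewrite (ler_chain vP) leqNgt jk /=.
  have -> : (j == k) = false by apply/eqP => jE; rewrite jE ltnn in jk.
  by apply/negP => /andP[_ /ks]; rewrite ltnNge ltnW.
- by rewrite eqxx lexx lerDl rho0.
- have jk := ks j js; rewrite (ler_chain vP) (ltnW jk) js andbT.
  by rewrite -val_eqE gtn_eqF.
Qed.

(** Invariant: the viewpoints [pre] already read are all within reach of the current anchor [a].
    Hence the first viewpoint out of reach is the next anchor. Fuel is spent only when a new anchor
    starts, so [size s] units suffice. *)
Lemma scan_from_left_induced rho fuel pre a s : 0 <= rho ->
  enum 'I_n = pre ++ s -> (forall k, k \in pre -> v k <= v a + rho) ->
  (size s <= fuel)%N ->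
  (scan_from v rho (v a) s).1.1 = [seq k <- s | v k <= v a + rho] /\
  [seq [set k in c]%SET | c : seq 'I_n <- (scan_from v rho (v a) s).1.2] =
  [seq [set k | v b <= v k <= v b + rho]%SET
    | b <- behead (anchors_from v rho fuel a)].
Proof.
move=> rho0; elim: s fuel pre a => [|k s IH] fuel pre a E prea sf.
  case: fuel sf => [//|fuel] _ /=; rewrite (next_anchor_None vP _).2 // => k.
  by apply: prea; rewrite -[pre]cats0 -E mem_enum.
have E' : enum 'I_n = rcons pre k ++ s by rewrite cat_rcons.
have [prek ks] := enum_ord_cat E.
have memk j : (j \in pre) || (k <= j)%N.
  have : j \in pre ++ k :: s by rewrite -E mem_enum.
  by rewrite mem_cat inE => /or3P[->|/eqP ->|/ks/ltnW ->]; rewrite ?leqnn ?orbT.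
rewrite /=; case: ifP => ka.
  have [||c_eq cs_eq] := IH fuel (rcons pre k) a E'.
  - by move=> j; rewrite mem_rcons inE => /predU1P[->|/prea].
  - exact: ltnW.
  by move: c_eq cs_eq; case: (scan_from _ _ _ _) => [[c cs] t] /= -> ->.
have {}ka : v a + rho < v k by rewrite ltNge ka.
case: fuel sf => [//|fuel] sf /=.
have -> : next_anchor v (v a + rho) = Some k.
  apply/(next_anchorP vP); split=> // j aj; rewrite (ler_chain vP).
  by case/orP: (memk j) => // /prea; rewrite leNgt aj.
have [|//|c_eq cs_eq] := IH fuel (rcons pre k) k E'.
  move=> j; rewrite mem_rcons inE => /predU1P[->|/prek jk].
    by rewrite lerDl.
  by have : v j < v k; [rewrite (ltr_chain vP) | lra].
(* Beyond the first viewpoint out of reach all others are out of reach too, so the cluster of [a] is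
   complete. *)
have -> : [seq j <- s | v j <= v a + rho] = [::].
  apply/eqP; rewrite -[_ == _]negbK -has_filter; apply/hasPn => j js.
  by rewrite -ltNge (lt_trans ka) // (ltr_chain vP) ks.
rewrite anchors_from_cons /=; move: c_eq cs_eq.
case: (scan_from _ _ _ _) => [[c cs] t] /= -> ->.
by rewrite (enum_ord_cluster rho0 E).
Qed.

Lemma scan_left_induced rho : 0 <= rho ->
  [seq [set k in c]%SET | c : seq 'I_n <- (scan v rho).1] = left_induced v rho.
Proof.
move=> rho0; rewrite /left_induced /anchors /scan.
case E: (enum 'I_n) => [|k s].
  by case: pickP => // a _; have := mem_enum 'I_n a; rewrite E.
have [_ ks] := @enum_ord_cat [::] k s E.
have k0 : nat_of_ord k = 0%N.
  have n0 : (0 < n)%N by apply: leq_ltn_trans (ltn_ord k).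
  have := mem_enum 'I_n (Ordinal n0); rewrite E inE => /orP[/eqP <- //|/ks].
  by rewrite ltn0.
case: pickP => [a /eqP a0|/(_ k)]; last by rewrite k0.
have -> : a = k by apply: val_inj; rewrite /= a0 k0.
have [||c_eq cs_eq] := @scan_from_left_induced rho n [:: k] k s rho0 E.
- by move=> j; rewrite inE => /eqP ->; rewrite lerDl.
- by have := size_enum_ord n; rewrite E /=; lia.
rewrite anchors_from_cons /=; move: c_eq cs_eq.
case: (scan_from _ _ _ _) => [[c cs] t] /= -> ->.
by rewrite (@enum_ord_cluster rho [::] k s rho0 E).
Qed.

(** * End points of the scanned clusters *)

Lemma left_end_sorted k s : sorted (fun i j : 'I_n => (i < j)%N) (k :: s) ->
  left_end v [set j in k :: s]%SET = v k.
Proof.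
move=> ks; apply: le_anti; rewrite left_end_le ?inE ?eqxx //=.
apply: le_bigmin; first exact: chain_le_length.
move=> j; rewrite !inE (ler_chain vP) => /predU1P[->//|js].
have : all (fun j : 'I_n => (k < j)%N) s.
  by apply: order_path_min ks => y x z; apply: ltn_trans.
by move/allP/(_ j js)/ltnW.
Qed.

Lemma right_end_sorted k s : sorted (fun i j : 'I_n => (i < j)%N) (k :: s) ->
  right_end v [set j in k :: s]%SET = v (last k s).
Proof.
move=> ks; apply: le_anti; apply/andP; split; last first.
  by rewrite right_end_ge // inE mem_last.
apply: bigmax_le; first exact: chain_ge0.
move=> j; rewrite inE (ler_chain vP); move: ks.
rewrite sorted_pairwise; last by move=> y x z; apply: ltn_trans.
rewrite lastI pairwise_rcons mem_rcons inE => /andP[/allP H _].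
by case/predU1P => [->//|/H/ltnW].
Qed.

Definition cluster_ends s : option (R * R) :=
  if s is k :: s' then Some (v k, v (last k s')) else None.

Lemma timed_lastE (T : Type) (x : T) (s : seq T) :
  timed_last x s = (last x s, (size s).+1).
Proof. by elim: s x => [//|y s IH] x /=; rewrite /bind /= IH. Qed.

Lemma robot_endsE m P :
  (robot_ends v m P).1 = mkseq (fun i => cluster_ends (nth [::] P i)) m.
Proof.
elim: m P => [//|m IH] P.
rewrite /mkseq /= -[1%N]addn0 iotaDl -map_comp.
have -> : [seq ((fun i => cluster_ends (nth [::] P i)) \o addn 1) i
             | i <- iota 0 m] =
    mkseq (fun i => cluster_ends (nth [::] (behead P) i)) m.
  by apply: eq_map => i; rewrite /= nth_behead.
rewrite -IH; case: P => [//|[//|k c] P] /=.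
by rewrite timed_lastE.
Qed.

(** Reaching the last viewpoint walks through the cluster once; the remaining work is constant per
    robot. *)
Lemma robot_ends_time m P :
  ((robot_ends v m P).2 <= size (flatten P) + 4 * m + 1)%N.
Proof.
elim: m P => [|m IH] P /=; first by rewrite addnC.
case: P => [|[|k c] P] /=.
- by have := IH [::]; rewrite /=; lia.
- by have := IH P; lia.
- by rewrite timed_lastE /= size_cat; have := IH P; lia.
Qed.

Lemma partition_ends_scan m rho :
  partition_ends v
    (pad (m := m) [seq [set k in c]%SET | c : seq 'I_n <- (scan v rho).1]) =
  (robot_ends v m (scan v rho).1).1.
Proof.
rewrite robot_endsE /mkseq -val_enum_ord -map_comp; apply: eq_map => i /=.
rewrite /pad; set P := (scan v rho).1.
have -> : nth set0 [seq [set k in c]%SET | c : seq 'I_n <- P] i =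
    [set k in nth [::] P i]%SET.
  have [iP|iP] := ltnP i (size P); first by rewrite (nth_map [::]).
  by rewrite !nth_default ?size_map //; apply/setP => k; rewrite !inE.
have : sorted (fun i j : 'I_n => (i < j)%N) (nth [::] P i).
  have [iP|iP] := ltnP i (size P); last by rewrite nth_default.
  by apply: (@scan_cluster_sorted rho); apply: mem_nth.
case: (nth [::] P i) => [_|k s ks].
  by rewrite ifT //; apply/eqP/setP => k; rewrite !inE.
rewrite ifF; last by apply/negbTE/set0Pn; exists k; rewrite !inE eqxx.
by rewrite left_end_sorted // right_end_sorted.
Qed.

End Scan.

(** * Running time of the bisection algorithm *)

Section Bisection.
Variables (R : realType) (n m : nat) (v : 'I_n -> R) (eps : R).
Hypothesis vP : chain v.
Implicit Types (s : bisection_state R (seq 'I_n)).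

(** Simulation map from the list implementation to the abstract algorithm on sets. *)
Definition bisection_abs s : bisection_state R {set 'I_n} :=
  (s.1, omap (map (fun c : seq 'I_n => [set k in c]%SET)) s.2).

(** Invariant keeping [rho] nonnegative, where scan and left-induced partition agree. *)
Definition bisection_state_wf s : Prop :=
  let: (a, b, rho, _) := s in [/\ 0 <= a, 0 <= b & rho = (a + b) / 2].

Lemma bisection_body_wf s : bisection_state_wf s ->
  bisection_state_wf (bisection_body (scan v) m s).1.
Proof.
case: s => [[[a b] rho] best] /= [a0 b0 ->].
by case: ifP => _ /=; split=> //; lra.
Qed.

Lemma bisection_body_abs s : bisection_state_wf s ->
  bisection_abs (bisection_body (scan v) m s).1 =
  (bisection_body (fun rho => ret (left_induced v rho)) m (bisection_abs s)).1.
Proof.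
case: s => [[[a b] rho] best] /= [a0 b0 rhoE].
have rho0 : 0 <= rho by lra.
by rewrite -(scan_left_induced vP rho0) size_map; case: ifP.
Qed.

(** Both versions see the same number of clusters, hence branch alike. The costs differ because the
    abstract subroutine is free of charge. *)
Lemma bisection_while_abs s s' c :
  while (bisection_guard eps) (bisection_body (scan v) m) s s' c ->
  bisection_state_wf s -> exists c',
  while (bisection_guard eps)
    (bisection_body (fun rho => ret (left_induced v rho)) m)
    (bisection_abs s) (bisection_abs s') c'.
Proof.
have gE u : bisection_guard eps (bisection_abs u) = bisection_guard eps u.
  by case: u => [[[]]].
elim=> {s s' c} [s gs|s s' c gs _ IH] wf.
  by eexists; apply: while_stop; rewrite gE.
have [c' W] := IH (bisection_body_wf wf).
eexists; apply: while_iter; first by rewrite gE.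
by rewrite -bisection_body_abs //; apply: W.
Qed.

Definition bisection_found (P : seq (seq 'I_n)) : Prop :=
  exists rho, P = (scan v rho).1.

(** The scan takes at most [5 * n + 1] steps, counting its clusters at most [n + 1], and four single
    steps follow. *)
Lemma bisection_body_time s : ((bisection_body (scan v) m s).2 <= 6 * n + 6)%N.
Proof.
case: s => [[[a b] rho] best] /=.
have := scan_time v rho; have := size_scan v rho.
by case: ifP => _ /=; lia.
Qed.

(** Either branch halves [b - a]. An iteration costs the body plus 3 steps for the guard; the final
    3 pay for the failing test. *)
Lemma bisection_terminates N (a b rho : R) P :
  bisection_state_wf (a, b, rho, Some P) -> bisection_found P ->
  b - a <= 2 * eps * 2 ^+ N ->
  exists a' b' rho' P' c,
    [/\ while (bisection_guard eps) (bisection_body (scan v) m)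
          (a, b, rho, Some P) (a', b', rho', Some P') c,
        bisection_found P' & (c <= N * (6 * n + 9) + 3)%N].
Proof.
elim: N a b rho P => [|N IH] a b rho P wf PP ba;
  have [g|g] := boolP (2 * eps < b - a).
- by move: ba g; rewrite expr0 mulr1; lra.
- exists a, b, rho, P, 3%N; split=> //.
  exact: (@while_stop _ (bisection_guard eps) _ (a, b, rho, Some P) (negbTE g)).
- have t6 := bisection_body_time (a, b, rho, Some P).
  have wf' := bisection_body_wf wf.
  have [a1 [b1 [rho1 [P1 [E1 PP1 ba1]]]]] : exists a1 b1 rho1 P1,
      [/\ (bisection_body (scan v) m (a, b, rho, Some P)).1 =
            (a1, b1, rho1, Some P1),
          bisection_found P1 & b1 - a1 = (b - a) / 2].
    move: wf => /= [_ _ rhoE]; case: ifP => _ /=.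
      by do 4!eexists; split=> //; lra.
    by do 4!eexists; split=> //; [exists rho | lra].
  rewrite E1 in wf'.
  have [|a' [b' [rho' [P' [c [W PP' cN]]]]]] := IH a1 b1 rho1 P1 wf' PP1.
    by rewrite ba1; move: ba; rewrite exprS; lra.
  exists a', b', rho', P'; eexists; split; [|exact: PP'|].
    apply: while_iter; first exact: g.
    by rewrite E1; apply: W.
  by move: t6 cN; rewrite [(bisection_guard _ _).2]/=; lia.
- exists a, b, rho, P, 3%N; split=> //; last by lia.
  exact: (@while_stop _ (bisection_guard eps) _ (a, b, rho, Some P) (negbTE g)).
Qed.

(** The first iteration is split off, as it produces the stored partition that
    [bisection_terminates] starts from. The 7 is 4 steps of initialisation and the last guard. *)
Lemma bisection_ex N : (0 < m)%N -> 0 < eps < chain_length v / m%:R ->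
  chain_length v / m%:R <= eps * 2 ^+ N ->
  exists P c, [/\ bisection (scan v) (chain_length v) m eps P c,
    bisection_found P,
    exists c', bisection (fun rho => ret (left_induced v rho))
      (chain_length v) m eps [seq [set k in c]%SET | c : seq 'I_n <- P] c'
    & (c <= N.+1 * (6 * n + 9) + 7)%N].
Proof.
move=> m0 /andP[eps0 epsm] qN.
set q := chain_length v / m%:R in epsm qN.
have q0 : 0 <= q by lra.
have iE (A : Type) : (bisection_init A (chain_length v) m).1 =
    (0, 2 * q, q, None).
  by rewrite /= -[_ / m%:R]mulrA -/q; congr (_, _, _, _); lra.
have sq : (size (scan v q).1 <= m)%N.
  have := congr1 size (scan_left_induced vP q0).
  by rewrite !size_map => ->; apply: size_anchors_mean.
set s0 : bisection_state R (seq 'I_n) := (0, 2 * q, q, None).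
have t6 := bisection_body_time s0.
(* at [rho = v_n / m] at most [m] clusters arise, hence the first iteration
   finds a partition *)
have E1 : (bisection_body (scan v) m s0).1 = (0, q, q / 2, Some (scan v q).1).
  by rewrite /= ltnNge sq /= add0r.
have wf0 : bisection_state_wf s0 by split=> //; lra.
have wf1 := bisection_body_wf wf0; rewrite E1 in wf1.
have [||a [b [rho [P [c [W PP cN]]]]]] := bisection_terminates (N := N) wf1.
- by exists q.
- by rewrite subr0; nra.
have {}W : while (bisection_guard eps) (bisection_body (scan v) m) s0
    (a, b, rho, Some P) (3 + (bisection_body (scan v) m s0).2 + c).
  apply: (@while_iter _ (bisection_guard eps)); first by rewrite /=; lra.
  by rewrite E1.
exists P; eexists; split.
- exists a, b, rho; eexists; split; last reflexivity.
  by rewrite iE; apply: W.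
- exact: PP.
- have [c' W'] := bisection_while_abs W wf0.
  eexists; exists a, b, rho, c'; split; last reflexivity.
  by rewrite iE; apply: W'.
- by rewrite [(bisection_init _ _ _).2]/=; lia.
Qed.

End Bisection.

(** * Logarithmic bound on the number of halvings, and conclusion *)

Lemma halvings_bound (R : realType) (q eps : R) : 0 < eps -> 0 < q ->
  exists N : nat, q <= eps * 2 ^+ N /\
    (eps <= q -> N%:R <= ln (q / eps) / ln 2 + 1).
Proof.
move=> eps0 q0; have x0 : 0 < q / eps by rewrite divr_gt0.
have ln20 : 0 < ln (2 : R) by rewrite ln_gt0 // ltr1n.
exists (Num.truncn (ln (q / eps) / ln 2)).+1; split.
  rewrite mulrC -ler_pdivrMr //.
  (* For a ratio at most 1 the logarithm is not positive, and any power of 2 suffices. *)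
  have [xle|xgt] := leP (q / eps) 1.
    by apply: le_trans xle _; rewrite exprn_ege1 // ler1n.
  rewrite -ler_ln ?posrE ?exprn_gt0 // lnXn //.
  rewrite -[ln 2 *+ _]mulr_natl -ler_pdivrMr //.
  have /truncn_itv/andP[_ /ltW//] : 0 <= ln (q / eps) / ln 2.
  by rewrite divr_ge0 // ltW // ln_gt0.
move=> epsq; have /truncn_itv/andP[+ _] : 0 <= ln (q / eps) / ln 2.
  by rewrite divr_ge0 ?(ltW ln20) // ln_ge0 // ler_pdivlMr // mul1r.
by rewrite -natr1; lra.
Qed.

Theorem mainTheorem7 (R : realType) :
  (* trajectory, image and minimality of the refresh time; [C * v_n <= Tf]
     renders "Tf is much larger than the single-robot visiting time v_n" *)
  (exists C : R,
     forall (n m : nat) (v : 'I_n -> R) (eps Tf : R)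
            (V : 'I_m -> {set 'I_n}) (park : 'I_m -> R),
       chain v -> (0 < m <= n)%N ->
       0 < eps < chain_length v / m%:R ->
       C * chain_length v <= Tf ->
       bisection_partition v eps V ->
       optimal_partition v V ->
       (forall i : 'I_m, V i = set0 ->
          0 <= park i <= chain_length v /\ forall k : 'I_n, park i != v k) ->
       let X := partition_trajectory v V park in
       [/\ team_trajectory v Tf X,
           image_of v Tf X =1 V,
           refresh_time v Tf X = 2 * dimension v V
         & forall Y : 'I_m -> R -> R, team_trajectory v Tf Y ->
             2 * dimension v V <= refresh_time v Tf Y]) /\
  (* running time O(n log (1 / eps)) *)
  (exists K : R,
     forall L : R, 0 < L ->
     exists eps0 : R, 0 < eps0 /\
     forall (n m : nat) (v : 'I_n -> R) (eps : R),
       chain v -> (0 < m <= n)%N ->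
       0 < eps < chain_length v / m%:R ->
       chain_length v / m%:R <= L -> eps <= eps0 ->
       exists (V : 'I_m -> {set 'I_n}) (c : nat),
         [/\ bisection_partition v eps V,
             design v m eps (partition_ends v V) c
           & c%:R <= K * n%:R * ln (eps^-1)]).
Proof.
split.
  exists 4 => n m v eps Tf V park vP /andP[m0 _] epsm lenT bV Vopt parkP X.
  have Vconv i k := bisection_partition_convex vP i k bV.
  split.
  - exact: partition_team_trajectory.
  - exact: partition_image.
  - by apply: partition_refresh_time => //; case: Vopt.
  - by move=> Y; apply: refresh_time_lower_bound.
have ln20 : 0 < ln (2 : R) by rewrite ln_gt0 // ltr1n.
(* With [M] the logarithm of [eps^-1]: [eps <= L^-1] gives [q / eps <= eps^-2], hence
   [N <= 2 * M / ln 2 + 1]; [eps <= expR (-1)] gives [1 <= M]. So [15 * N + 28] is at most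
   [30 / ln 2 * M + 43], and [58 * M] absorbs the 43. *)
exists (30 / ln 2 + 58) => L L0; exists (Num.min L^-1 (expR (-1))).
split; first by rewrite lt_min invr_gt0 L0 expR_gt0.
move=> n m v eps vP /andP[m0 mn] epsm qL; rewrite le_min => /andP[epsL epse].
have /andP[eps0 epsq] := epsm.
set q := chain_length v / m%:R in qL epsq.
have q0 : 0 < q by lra.
have [N [qN /(_ (ltW epsq)) NP]] := halvings_bound eps0 q0.
have [P [c [bP [rho PE] [c' bP'] cN]]] := bisection_ex vP m0 epsm qN.
exists (pad [seq [set k in c]%SET | c : seq 'I_n <- P]).
exists (c + (robot_ends v m P).2)%N; split.
- by exists [seq [set k in c]%SET | c : seq 'I_n <- P], c'; split.
- by exists P, c; split=> //; split=> //; rewrite PE partition_ends_scan.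
(* As [1 <= n] and [m <= n], the bisection costs at most [15 * n * (N + 1) + 7 * n] and the end
   points at most [6 * n]. *)
have Mn : (c + (robot_ends v m P).2 <= n * (15 * N + 28))%N.
  have := robot_ends_time v m P; rewrite {2}PE scan_flatten size_enum_ord.
  nia.
set M := ln eps^-1.
have M1 : 1 <= M.
  rewrite -[1]expRK ler_ln ?posrE ?invr_gt0 ?expR_gt0 //.
  by rewrite -[expR 1]invrK lef_pV2 ?posrE ?invr_gt0 ?expR_gt0 // -expRN.
have qM : ln (q / eps) <= 2 * M.
  have -> : 2 * M = ln (eps^-1 * eps^-1).
    by rewrite lnM ?posrE ?invr_gt0 // mulr_natl mulr2n.
  have epsV : 0 < eps^-1 by rewrite invr_gt0.
  rewrite ler_ln ?posrE; [|exact: mulr_gt0..].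
  rewrite ler_pM2r //; apply: le_trans qL _.
  by rewrite -[L]invrK lef_pV2 ?posrE ?invr_gt0.
have NM : N%:R <= 2 * M / ln 2 + 1.
  by apply: le_trans NP _; rewrite lerD2r ler_pM2r ?invr_gt0.
have : (c + (robot_ends v m P).2)%:R <= n%:R * (15 * N%:R + 28) :> R.
  by rewrite -!natrM -natrD -natrM ler_nat.
move/le_trans; apply; rewrite [_ * n%:R]mulrC -mulrA; apply: ler_wpM2l => //.
have E : 30 / ln 2 * M = 15 * (2 * M / ln 2) by field; lra.
lra.
Qed.
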